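(* Let $x_{3\setminus0}=x_3-x_0$ and let $L_{x_0},L_{x_-},L_{x_+},L_{x_{3\setminus0}}$ and $B_{x_0},B_{x_-},B_{x_+},B_{x_{3\setminus0}}$ be the matrices over quantum Minkowski space $\mathcal X$ defined in the context. Their powers are as follows. For all $n\ge1$: $$L_{x_0}^n=\begin{pmatrix}B_{x_0}^n&0\\0&B_{x_0}^n\end{pmatrix},\qquad L_{x_+}^n=\begin{pmatrix}q^{-n}B_{x_+}^n&0\\0&q^nB_{x_+}^n\end{pmatrix},$$ $$L_{x_-}^n=\begin{pmatrix}q^nB_{x_-}^n&q^{-1/2}\lambda[2]^{1/2}\Bigl(q^{n-1}\frac{[2n]}{[2]}B_{x_{3\setminus0}}+[n]B_{x_0}\Bigr)B_{x_-}^{n-1}\\0&q^{-n}B_{x_-}^n\end{pmatrix},$$ $$L_{x_{3\setminus0}}^n=\begin{pmatrix}B_{x_{3\setminus0}}^n&q^{-1/2}\lambda[2]^{1/2}q^{n-1}[n]\,B_{x_+}B_{x_{3\setminus0}}^{n-1}\\0&B_{x_{3\setminus0}}^n\end{pmatrix},$$ where $$B_{x_{3\setminus0}}^n=\begin{pmatrix}q^{-n}x_{3\setminus0}^n&0\\0&q^nx_{3\setminus0}^n\end{pmatrix},\quad B_{x_-}^n=\begin{pmatrix}x_-^n&q^{-1/2}\lambda[2]^{-1/2}q^{n-1}[n]\,x_{3\setminus0}x_-^{n-1}\\0&x_-^n\end{pmatrix},$$ $$B_{x_+}^n=\begin{pmatrix}x_+^n&0\\-q^{1/2}\lambda[2]^{-1/2}q^{1-n}[n]\,x_{3\setminus0}x_+^{n-1}&x_+^n\end{pmatrix}.$$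 Moreover, with the central elements $b=\frac{[2]}2x_0$ and $c=(x_0)^2+\frac{\lambda^2}{[2]^2}x^2$ and with $U_n$ the Chebyshev polynomials of the second kind, for all $n\ge2$: $$L_{x_0}^n=-U_{n-2}\bigl(b/\sqrt c\bigr)\,c^{\frac n2}+U_{n-1}\bigl(b/\sqrt c\bigr)\,c^{\frac{n-1}2}\,L_{x_0}=U_n\bigl(b/\sqrt c\bigr)\,c^{\frac n2}+U_{n-1}\bigl(b/\sqrt c\bigr)\,c^{\frac{n-1}2}\,(L_{x_0}-2b).$$
   Context: Fix a real $q>0$, $q\neq1$. Put $\lambda=q-q^{-1}$, $[n]=\frac{q^n-q^{-n}}{q-q^{-1}}$. $\mathcal X$ (quantum Minkowski space) is the unital complex algebra generated by $x_0,x_-,x_+,x_3$ with relations: $x_0$ commutes with all generators; $q^{-1}x_-x_3-qx_3x_-=-\lambda x_-x_0$; $q^{-1}x_3x_+-qx_+x_3=-\lambda x_+x_0$; $x_-x_+-x_+x_--\lambda x_3x_3=-\lambda x_3x_0$. Put $x_{3\setminus0}:=x_3-x_0$ and $x^2:=(x_0)^2+q^{-1}x_-x_++qx_+x_--(x_3)^2$, which is central. Define $2\times2$ matrices over $\mathcal X$ $$B_{x_0}=\begin{pmatrix}\frac{[4]}{[2]^2}x_0+\frac{\lambda}{q[2]}x_3&q^{-1/2}\lambda[2]^{-1/2}x_+\\-q^{1/2}\lambda[2]^{-1/2}x_-&\frac{[4]}{[2]^2}x_0-\frac{q\lambda}{[2]}x_3\end{pmatrix},\quad B_{x_-}=\begin{pmatrix}x_-&q^{-1/2}\lambda[2]^{-1/2}x_{3\setminus0}\\0&x_-\end{pmatrix},$$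 $$B_{x_+}=\begin{pmatrix}x_+&0\\-q^{1/2}\lambda[2]^{-1/2}x_{3\setminus0}&x_+\end{pmatrix},\quad B_{x_{3\setminus0}}=\begin{pmatrix}q^{-1}x_{3\setminus0}&0\\0&qx_{3\setminus0}\end{pmatrix},\quad B_{x_3}=B_{x_{3\setminus0}}+B_{x_0},$$ and $4\times4$ matrices over $\mathcal X$ in $2\times2$ block form $$L_{x_0}=\begin{pmatrix}B_{x_0}&0\\0&B_{x_0}\end{pmatrix},\; L_{x_-}=\begin{pmatrix}qB_{x_-}&q^{-1/2}\lambda[2]^{1/2}B_{x_3}\\0&q^{-1}B_{x_-}\end{pmatrix},\; L_{x_+}=\begin{pmatrix}q^{-1}B_{x_+}&0\\0&qB_{x_+}\end{pmatrix},\; L_{x_{3\setminus0}}=\begin{pmatrix}B_{x_{3\setminus0}}&q^{-1/2}\lambda[2]^{1/2}B_{x_+}\\0&B_{x_{3\setminus0}}\end{pmatrix}.$$ (These represent the action of the universal $L$-matrix of the quantum Lorentz algebra on the generators.) Chebyshev polynomials of the second kind are given by $\frac1{1-2yt+t^2}=\sum_{n\ge0}U_n(y)t^n$. Since $U_n$ has the parity of $n$ and degree $n$, the expression $U_n(b/\sqrt c)\,c^{n/2}$ denotes a polynomial in $b$ and $c$; it is thus a well-defined central element of $\mathcal X$ (and $U_{n-2}(b/\sqrt c)\,c^{n/2}=c\cdot U_{n-2}(b/\sqrt c)\,c^{(n-2)/2}$). Central elements are identified with scalar matrices. *)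

(* Defs.v *)
From HB Require Import structures.
From mathcomp Require Import all_boot all_order all_algebra.
From mathcomp Require Import generic_quotient ring_quotient.
From mathcomp Require Import boolp reals complex monalg.
From mathcomp Require Import zify.

Set Implicit Arguments.
Unset Strict Implicit.
Unset Printing Implicit Defensive.

Import Order.TTheory GRing.Theory Num.Theory.

Local Open Scope ring_scope.

(* The free unital associative K-algebra on n generators, as the monoid algebra
   of the free monoid. *)
Definition freeAlg (K : comNzRingType) (n : nat) : Type :=
  {malg K[{fmonom 'I_n}]}.

Section FreeAlgebra.
Variables (K : comNzRingType) (n : nat).

HB.instance Definition _ := GRing.Lalgebra.copy (freeAlg K n)
  {malg K[{fmonom 'I_n}]}.

Lemma freeAlg_scaleAr (c : K) (u v : freeAlg K n) :
  c *: (u * v) = u * (c *: v).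
Proof.
have aux (g h : {malg K[{fmonom 'I_n}]}) : c *: (g * h) = g * (c *: h).
  rewrite -(mul_malgC c h) mulrA -(mul_malgC c (g * h)) mulrA.
  suff -> : g * c%:MP = c%:MP * g by [].
  rewrite malgM_def fgmulgU mul_malgC malgZ_def.
  by apply: eq_bigr => i _; rewrite mulm1 mulrC.
exact: aux.
Qed.

HB.instance Definition _ :=
  GRing.Lalgebra_isAlgebra.Build K (freeAlg K n) freeAlg_scaleAr.

Definition free_gen (i : 'I_n) : freeAlg K n := << fmu i >>.

(* The augmentation, sending every generator to 0. *)
Definition free_aug (u : freeAlg K n) : K^o :=
  (u : {malg K[{fmonom 'I_n}]})@_mone.

Lemma free_aug_monoid_morphism : monoid_morphism free_aug.
Proof.
split; first by rewrite /free_aug mcoeff1 eqxx.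
exact: (rmorphM (@mcoeff {fmonom 'I_n} K mone)).
Qed.

Lemma free_aug_zmod_morphism : zmod_morphism free_aug.
Proof. exact: mcoeffB. Qed.

Lemma free_aug_scalable : scalable free_aug.
Proof. by move=> c u; apply: mcoeffZ. Qed.

HB.instance Definition _ := GRing.isZmodMorphism.Build _ _ free_aug
  free_aug_zmod_morphism.
HB.instance Definition _ := GRing.isMonoidMorphism.Build _ _ free_aug
  free_aug_monoid_morphism.
HB.instance Definition _ := GRing.isScalable.Build _ _ _ _ free_aug
  free_aug_scalable.

Lemma free_aug_gen i : free_aug (free_gen i) = 0.
Proof.
rewrite /free_aug /free_gen mcoeffU1.
by case: eqP => // /(congr1 (fun m => size (fmonom_val m))); rewrite fmU fm1.
Qed.

End FreeAlgebra.

Section QuotientAlgebra.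
Variables (K : comNzRingType) (A : algType K) (rel : A -> A -> Prop).

(* The two-sided ideal generated by all the differences u - v with rel u v. *)
Inductive in_ideal : A -> Prop :=
| in_ideal_gen u v of rel u v : in_ideal (u - v)
| in_ideal0 : in_ideal 0
| in_idealB u v of in_ideal u & in_ideal v : in_ideal (u - v)
| in_idealMl a u of in_ideal u : in_ideal (a * u)
| in_idealMr a u of in_ideal u : in_ideal (u * a).

Definition rel_ideal : {pred A} := fun u => `[< in_ideal u >].

Lemma rel_idealP u : reflect (in_ideal u) (u \in rel_ideal).
Proof. exact: asboolP. Qed.

Lemma rel_ideal_zmod_closed : zmod_closed rel_ideal.
Proof.
split=> [|u v /rel_idealP hu /rel_idealP hv]; apply/rel_idealP.
  exact: in_ideal0.
exact: in_idealB.
Qed.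

HB.instance Definition _ := GRing.isZmodClosed.Build A rel_ideal
  rel_ideal_zmod_closed.

Lemma rel_idealMl a u : u \in rel_ideal -> a * u \in rel_ideal.
Proof. by move/rel_idealP => hu; apply/rel_idealP; apply: in_idealMl. Qed.

Lemma rel_idealMr a u : u \in rel_ideal -> u * a \in rel_ideal.
Proof. by move/rel_idealP => hu; apply/rel_idealP; apply: in_idealMr. Qed.

Lemma rel_idealZ c u : u \in rel_ideal -> c *: u \in rel_ideal.
Proof. by move=> hu; rewrite -[u]mul1r scalerAl rel_idealMl. Qed.

Lemma rel_ideal_sub_ker (B : nzRingType) (f : {rmorphism A -> B}) :
  (forall u v, rel u v -> f u = f v) -> forall u, u \in rel_ideal -> f u = 0.
Proof.
move=> frel u /rel_idealP; elim=> {u} [u v huv||u v _ hu _ hv|a u _ hu|a u _ hu].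
- by rewrite rmorphB (frel _ _ huv) subrr.
- exact: rmorph0.
- by rewrite rmorphB hu hv subrr.
- by rewrite rmorphM hu mulr0.
- by rewrite rmorphM hu mul0r.
Qed.

(* The parameter only serves to make the quotient a nonzero ring. *)
Definition quotAlg of 1 \notin rel_ideal : Type := {ideal_quot rel_ideal}.

Variable proper : 1 \notin rel_ideal.
Local Notation Q := (quotAlg proper).

HB.instance Definition _ := GRing.Zmodule.copy Q {ideal_quot rel_ideal}.

Definition quot_proj (u : A) : Q := \pi_({ideal_quot rel_ideal})%qT u.
Definition quot_repr (x : Q) : A := repr (x : {ideal_quot rel_ideal}).

Lemma quot_reprK x : quot_proj (quot_repr x) = x.
Proof. exact: reprK. Qed.

Lemma quot_projP u v :
  reflect (quot_proj u = quot_proj v) (u - v \in rel_ideal).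
Proof. by rewrite Quotient.idealrBE; apply: eqP. Qed.

Lemma quot_proj_zmod_morphism : zmod_morphism quot_proj.
Proof. by move=> u v; rewrite /quot_proj raddfB. Qed.

HB.instance Definition _ := GRing.isZmodMorphism.Build A Q quot_proj
  quot_proj_zmod_morphism.

Definition quot_one : Q := locked (quot_proj 1).
Definition quot_mul (x y : Q) : Q :=
  locked (quot_proj (quot_repr x * quot_repr y)).
Definition quot_scale (c : K) (x : Q) : Q :=
  locked (quot_proj (c *: quot_repr x)).

Fact quot_proj1 : quot_proj 1 = quot_one.
Proof. by rewrite /quot_one -lock. Qed.

Fact quot_projM u v : quot_proj (u * v) = quot_mul (quot_proj u) (quot_proj v).
Proof.
rewrite /quot_mul -lock; apply/quot_projP.
set u' := quot_repr _; set v' := quot_repr _.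
have hu : u - u' \in rel_ideal by apply/quot_projP; rewrite quot_reprK.
have hv : v - v' \in rel_ideal by apply/quot_projP; rewrite quot_reprK.
have -> : u * v - u' * v' = (u - u') * v + u' * (v - v').
  by rewrite mulrBl mulrBr addrA subrK.
by apply: rpredD; [apply: rel_idealMr | apply: rel_idealMl].
Qed.

Fact quot_projZ c u : quot_proj (c *: u) = quot_scale c (quot_proj u).
Proof.
rewrite /quot_scale -lock; apply/quot_projP; rewrite -scalerBr rel_idealZ //.
by apply/quot_projP; rewrite quot_reprK.
Qed.

Let reprE x : x = quot_proj (quot_repr x). Proof. by rewrite quot_reprK. Qed.

Fact quot_mulA : associative quot_mul.
Proof.
by move=> x y z; rewrite (reprE x) (reprE y) (reprE z) -!quot_projM mulrA.
Qed.

Fact quot_mul1 : left_id quot_one quot_mul.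
Proof. by move=> x; rewrite (reprE x) -quot_proj1 -quot_projM mul1r. Qed.

Fact quot_mulr1 : right_id quot_one quot_mul.
Proof. by move=> x; rewrite (reprE x) -quot_proj1 -quot_projM mulr1. Qed.

Fact quot_mulDl : left_distributive quot_mul +%R.
Proof.
move=> x y z; rewrite (reprE x) (reprE y) (reprE z).
by rewrite -raddfD -!quot_projM mulrDl raddfD.
Qed.

Fact quot_mulDr : right_distributive quot_mul +%R.
Proof.
move=> x y z; rewrite (reprE x) (reprE y) (reprE z).
by rewrite -raddfD -!quot_projM mulrDr raddfD.
Qed.

Fact quot_one_neq0 : quot_one != 0.
Proof.
apply/eqP; rewrite -quot_proj1 -(raddf0 quot_proj) => /quot_projP.
by rewrite subr0 (negPf proper).
Qed.

HB.instance Definition _ := GRing.Zmodule_isNzRing.Build Q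
  quot_mulA quot_mul1 quot_mulr1 quot_mulDl quot_mulDr quot_one_neq0.

Fact quot_scaleA a b x : quot_scale a (quot_scale b x) = quot_scale (a * b) x.
Proof. by rewrite (reprE x) -!quot_projZ scalerA. Qed.

Fact quot_scale1 : left_id 1 quot_scale.
Proof. by move=> x; rewrite (reprE x) -quot_projZ scale1r. Qed.

Fact quot_scaleDr : right_distributive quot_scale +%R.
Proof.
move=> a x y; rewrite (reprE x) (reprE y).
by rewrite -raddfD -!quot_projZ scalerDr raddfD.
Qed.

Fact quot_scaleDl x : {morph quot_scale^~ x : a b / a + b}.
Proof. by move=> a b; rewrite (reprE x) -!quot_projZ scalerDl raddfD. Qed.

HB.instance Definition _ := GRing.Zmodule_isLmodule.Build K Q
  quot_scaleA quot_scale1 quot_scaleDr quot_scaleDl.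

Fact quot_scaleAl (a : K) (x y : Q) : a *: (x * y) = a *: x * y.
Proof.
change (quot_scale a (quot_mul x y) = quot_mul (quot_scale a x) y).
by rewrite (reprE x) (reprE y) -quot_projM -!quot_projZ -quot_projM scalerAl.
Qed.

HB.instance Definition _ := GRing.Lmodule_isLalgebra.Build K Q quot_scaleAl.

Fact quot_scaleAr (a : K) (x y : Q) : a *: (x * y) = x * (a *: y).
Proof.
change (quot_scale a (quot_mul x y) = quot_mul x (quot_scale a y)).
by rewrite (reprE x) (reprE y) -quot_projM -!quot_projZ -quot_projM scalerAr.
Qed.

HB.instance Definition _ := GRing.Lalgebra_isAlgebra.Build K Q quot_scaleAr.

Fact quot_proj_monoid_morphism : monoid_morphism quot_proj.
Proof. by split; [apply: quot_proj1 | apply: quot_projM]. Qed.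

HB.instance Definition _ := GRing.isMonoidMorphism.Build A Q quot_proj
  quot_proj_monoid_morphism.

Fact quot_proj_scalable : scalable quot_proj.
Proof. exact: quot_projZ. Qed.

HB.instance Definition _ := GRing.isScalable.Build K A Q _ quot_proj
  quot_proj_scalable.

End QuotientAlgebra.

Section AlgebraQuotient.
Variables (K : comNzRingType) (A : algType K) (rel : A -> A -> Prop).

(* A quotient algebra A -> Q with kernel the ideal generated by rel. *)
Record alg_quotient : Type := AlgQuotient {
  quotient_alg : algType K;
  quotient_map : {lrmorphism A -> quotient_alg};
  quotient_surj : forall x, exists u, quotient_map u = x;
  quotient_mapP : forall u v, quotient_map u = quotient_map v <-> in_ideal rel (u - v)
}.

(* Opaque, so that unification never unfolds the operations of the quotient. *)
Lemma alg_quotient_exists : 1 \notin rel_ideal rel -> alg_quotient.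
Proof.
move=> p; refine (@AlgQuotient (quotAlg p) (quot_proj p) _ _) => [x|u v].
  by exists (quot_repr x); apply: quot_reprK.
by split=> [/quot_projP/rel_idealP | h]; last apply/quot_projP/rel_idealP.
Qed.

End AlgebraQuotient.

Notation "r *' x" := (r%:C%C *: x) (at level 40) : ring_scope.

Section QuantumMinkowski.
Variables (R : realType) (q : R).

Definition qnum (n : nat) : R := (q ^+ n - q ^- n) / (q - q^-1).

Definition qlambda : R := q - q^-1.

Local Notation lam := qlambda.

Inductive qMinkowski_rel (A : algType R[i]) (x0 xm xp x3 : A) : A -> A -> Prop :=
| qMinkowski_rel0m : qMinkowski_rel x0 xm xp x3 (x0 * xm) (xm * x0)
| qMinkowski_rel0p : qMinkowski_rel x0 xm xp x3 (x0 * xp) (xp * x0)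
| qMinkowski_rel03 : qMinkowski_rel x0 xm xp x3 (x0 * x3) (x3 * x0)
| qMinkowski_relm3 : qMinkowski_rel x0 xm xp x3
    (q^-1 *' (xm * x3) - q *' (x3 * xm)) (- (lam *' (xm * x0)))
| qMinkowski_rel3p : qMinkowski_rel x0 xm xp x3
    (q^-1 *' (x3 * xp) - q *' (xp * x3)) (- (lam *' (xp * x0)))
| qMinkowski_relmp : qMinkowski_rel x0 xm xp x3
    (xm * xp - xp * xm - lam *' (x3 * x3)) (- (lam *' (x3 * x0))).

Lemma qMinkowski_rel_morph (A B : algType R[i]) (f : {lrmorphism A -> B})
    (x0 xm xp x3 u v : A) :
  qMinkowski_rel x0 xm xp x3 u v ->
  qMinkowski_rel (f x0) (f xm) (f xp) (f x3) (f u) (f v).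
Proof.
have fZ c w : f (c *: w) = c *: f w by exact: linearZ.
have fM w z : f (w * z) = f w * f z by exact: rmorphM.
have fB w z : f (w - z) = f w - f z by exact: rmorphB.
have fN w : f (- w) = - f w by exact: rmorphN.
case; rewrite ?(fB, fN, fZ, fM).
all: by constructor.
Qed.

Lemma qMinkowski_rel_image (A B : algType R[i]) (f : {lrmorphism A -> B})
    (x0 xm xp x3 : A) :
  (forall u v, qMinkowski_rel x0 xm xp x3 u v -> f u = f v) ->
  forall u v, qMinkowski_rel (f x0) (f xm) (f xp) (f x3) u v -> u = v.
Proof.
have fZ c w : f (c *: w) = c *: f w by exact: linearZ.
have fM w z : f (w * z) = f w * f z by exact: rmorphM.
have fB w z : f (w - z) = f w - f z by exact: rmorphB.
have fN w : f (- w) = - f w by exact: rmorphN.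
move=> frel u v []; rewrite -!fM -?fZ -?fB -?fN.
- by apply: frel; exact: qMinkowski_rel0m.
- by apply: frel; exact: qMinkowski_rel0p.
- by apply: frel; exact: qMinkowski_rel03.
- by apply: frel; exact: qMinkowski_relm3.
- by apply: frel; exact: qMinkowski_rel3p.
- by apply: frel; exact: qMinkowski_relmp.
Qed.

Lemma qMinkowski_rel_zero (A : algType R[i]) (u v : A) :
  qMinkowski_rel 0 0 0 0 u v -> u = v.
Proof. by case; rewrite ?mulr0 ?scaler0 ?subr0 ?oppr0. Qed.

(* The generators 0, 1, 2, 3 of the free algebra stand for x_0, x_-, x_+, x_3. *)
Definition qMinkowski_free_rel : freeAlg R[i] 4 -> freeAlg R[i] 4 -> Prop :=
  qMinkowski_rel (free_gen _ (inord 0)) (free_gen _ (inord 1))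
                 (free_gen _ (inord 2)) (free_gen _ (inord 3)).

Lemma qMinkowski_proper : 1 \notin rel_ideal qMinkowski_free_rel.
Proof.
apply/negP => /(@rel_ideal_sub_ker _ _ _ _ (@free_aug R[i] 4)).
rewrite rmorph1 => h; suff /h/eqP : forall u v, qMinkowski_free_rel u v ->
  free_aug u = free_aug v by rewrite oner_eq0.
move=> u v /(qMinkowski_rel_morph (@free_aug R[i] 4)).
by rewrite /= !free_aug_gen => /qMinkowski_rel_zero.
Qed.

Definition qMinkowski_quotient : alg_quotient qMinkowski_free_rel :=
  alg_quotient_exists qMinkowski_proper.

Definition qMinkowski : algType R[i] := quotient_alg qMinkowski_quotient.

Local Notation X := qMinkowski.

Definition qM_gen (i : 'I_4) : X :=
  quotient_map qMinkowski_quotient (free_gen _ i).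

Definition qM_x0 : X := qM_gen (inord 0).
Definition qM_xm : X := qM_gen (inord 1).
Definition qM_xp : X := qM_gen (inord 2).
Definition qM_x3 : X := qM_gen (inord 3).

Lemma qMinkowski_relE (u v : X) :
  qMinkowski_rel qM_x0 qM_xm qM_xp qM_x3 u v -> u = v.
Proof.
apply: (qMinkowski_rel_image (f := quotient_map qMinkowski_quotient)).
by move=> a b hab; apply/quotient_mapP; apply: in_ideal_gen.
Qed.

Definition qM_x30 : X := qM_x3 - qM_x0.

Local Notation x0 := qM_x0.
Local Notation xm := qM_xm.
Local Notation xp := qM_xp.
Local Notation x3 := qM_x3.
Local Notation x30 := qM_x30.

Definition qM_square : X :=
  x0 ^+ 2 + q^-1 *' (xm * xp) + q *' (xp * xm) - x3 ^+ 2.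

Definition mx22 (T : Type) (a b c d : T) : 'M[T]_2 :=
  \matrix_(i < 2, j < 2)
    if i == 0 then (if j == 0 then a else b) else (if j == 0 then c else d).

Definition rscale (m n : nat) (r : R) (M : 'M[X]_(m, n)) : 'M[X]_(m, n) :=
  map_mx (fun x => r *' x) M.

Local Notation sq := (Num.sqrt q).
Local Notation s2 := (Num.sqrt (qnum 2)).

Definition B_x0 : 'M[X]_2 :=
  mx22 ((qnum 4 / qnum 2 ^+ 2) *' x0 + (lam / (q * qnum 2)) *' x3)
       ((sq^-1 * lam * s2^-1) *' xp)
       (- ((sq * lam * s2^-1) *' xm))
       ((qnum 4 / qnum 2 ^+ 2) *' x0 - (q * lam / qnum 2) *' x3).

Definition B_xm : 'M[X]_2 := mx22 xm ((sq^-1 * lam * s2^-1) *' x30) 0 xm.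

Definition B_xp : 'M[X]_2 := mx22 xp 0 (- ((sq * lam * s2^-1) *' x30)) xp.

Definition B_x30 : 'M[X]_2 := mx22 (q^-1 *' x30) 0 0 (q *' x30).

Definition B_x3 : 'M[X]_2 := B_x30 + B_x0.

Definition L_x0 : 'M[X]_(2 + 2) := block_mx B_x0 0 0 B_x0.

Definition L_xm : 'M[X]_(2 + 2) :=
  block_mx (rscale q B_xm) (rscale (sq^-1 * lam * s2) B_x3)
           0 (rscale q^-1 B_xm).

Definition L_xp : 'M[X]_(2 + 2) :=
  block_mx (rscale q^-1 B_xp) 0 0 (rscale q B_xp).

Definition L_x30 : 'M[X]_(2 + 2) :=
  block_mx B_x30 (rscale (sq^-1 * lam * s2) B_xp) 0 B_x30.

Definition central_b : X := (qnum 2 / 2) *' x0.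

Definition central_c : X := x0 ^+ 2 + (lam ^+ 2 / qnum 2 ^+ 2) *' qM_square.

End QuantumMinkowski.

Section Chebyshev.
Variables (K : comNzRingType) (U : nat -> {poly K}).

(* (1 - 2 y t + t^2) * (\sum_n U_n(y) t^n) = 1 as power series in t over K[y]:
   the left factor is a polynomial in t, and the sum below is the coefficient
   of t^n in the Cauchy product. *)
Definition is_chebyshevU : Prop :=
  forall n, \sum_(i < n.+1)
    (1 - ('X *+ 2)%:P * 'X + 'X^2 : {poly {poly K}})`_i * U (n - i)
    = (n == 0)%:R.

(* The polynomial U_n(b / sqrt c) c^(n/2) in b and c; see chebU_homogE. *)
Definition chebU_homog (A : algType K) (n : nat) (b c : A) : A :=
  \sum_(k < n.+1 | ~~ odd (n - k)) (U n)`_k *: (b ^+ k * c ^+ (n - k)./2).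

End Chebyshev.

Section ChebyshevTheory.
Variable K : comNzRingType.

Lemma is_chebyshevU_rec (U : nat -> {poly K}) :
  is_chebyshevU U <->
  [/\ U 0 = 1, U 1 = 'X *+ 2 & forall n, U n.+2 = 'X *+ 2 * U n.+1 - U n].
Proof.
rewrite /is_chebyshevU; set D := (1 - ('X *+ 2)%:P * 'X + 'X^2).
have D0 : D`_0 = 1 by rewrite /D !(coefD, coefN, coefCM, coefX, coefXn, coefC) /= !(mulr0, subr0, addr0).
have D1 : D`_1 = - ('X *+ 2) by rewrite /D !(coefD, coefN, coefCM, coefX, coefXn, coefC) /= mulr1 sub0r addr0.
have D2 : D`_2 = 1 by rewrite /D !(coefD, coefN, coefCM, coefX, coefXn, coefC) /= mulr0 subr0 add0r.
have D3 n : D`_n.+3 = 0 by rewrite /D !(coefD, coefN, coefCM, coefX, coefXn, coefC) /= mulr0 subr0 add0r.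
have S0 : \sum_(i < 1) D`_i * U (0 - i)%N = U 0.
  by rewrite big_ord1 D0 mul1r.
have S1 : \sum_(i < 2) D`_i * U (1 - i)%N = U 1 - 'X *+ 2 * U 0.
  by rewrite !big_ord_recl big_ord0 /= D0 D1 mul1r mulNr addr0.
have S2 n : \sum_(i < n.+3) D`_i * U (n.+2 - i)%N
    = U n.+2 - 'X *+ 2 * U n.+1 + U n.
  rewrite !big_ord_recl /= !/bump /= D0 D1 D2 !mul1r mulNr !subSS !subn0.
  rewrite big1 ?addr0 ?addrA // => i _.
  by rewrite /bump /= D3 mul0r.
split=> [h | [h0 h1 h2] [|[|n]]].
- have u0 : U 0 = 1 by rewrite -S0 h.
  split=> // [|n]; apply/eqP; rewrite -subr_eq0.
    by have := h 1; rewrite S1 u0 mulr1 => ->.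
  by have := h n.+2; rewrite S2 opprB addrCA addrC => ->.
- by rewrite S0.
- by rewrite S1 h0 h1 mulr1 subrr.
- by rewrite S2 h2 addrAC subrK subrr.
Qed.

Fixpoint chebU_pair (n : nat) : {poly K} * {poly K} :=
  if n is m.+1 then
    let: (u, v) := chebU_pair m in (v, 'X *+ 2 * v - u)
  else (1, 'X *+ 2).

Lemma is_chebyshevU_exists : is_chebyshevU (fun n => (chebU_pair n).1).
Proof.
apply/is_chebyshevU_rec; split=> // n /=.
by case: (chebU_pair n).
Qed.

Lemma is_chebyshevU_unique (U V : nat -> {poly K}) :
  is_chebyshevU U -> is_chebyshevU V -> U =1 V.
Proof.
move=> /is_chebyshevU_rec[u0 u1 ur] /is_chebyshevU_rec[v0 v1 vr] n.
suff [] : U n = V n /\ U n.+1 = V n.+1 by [].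
elim: n => [|n [IH IH1]]; first by rewrite u0 u1 v0 v1.
by rewrite ur vr IH IH1.
Qed.

Lemma chebU_coef_eq0 (U : nat -> {poly K}) : is_chebyshevU U ->
  forall n k, (n < k)%N || odd (n + k) -> (U n)`_k = 0.
Proof.
move=> /is_chebyshevU_rec[u0 u1 ur] n.
suff [] : (forall k, (n < k)%N || odd (n + k) -> (U n)`_k = 0) /\
  (forall k, (n.+1 < k)%N || odd (n.+1 + k) -> (U n.+1)`_k = 0) by [].
elim: n => [|n [IH IH1]].
  split=> k; rewrite ?u0 ?u1 ?coef1 ?coefMn ?coefX.
    by case: k.
  by case: k => [|[|k]] //= _; rewrite mul0rn.
split=> // -[|k] hk; rewrite ur coefB mulrnAl coefMn coefXM /=.
  by rewrite mul0rn IH ?subr0 //; move: hk; rewrite !addn0 /= negbK => ->; rewrite ?orbT.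
rewrite IH1 ?IH ?mul0rn ?subr0 //.
  by move: hk; lia.
by move: hk; lia.
Qed.

End ChebyshevTheory.

Lemma chebU_homogE (F : fieldType) (U : nat -> {poly F}) (n : nat) (b s : F^o) :
  is_chebyshevU U -> s != 0 ->
  chebU_homog U n b (s ^+ 2) = (U n).[b / s] * s ^+ n.
Proof.
move=> hU s0; rewrite /chebU_homog big_mkcond (@horner_coef_wide _ n.+1); last first.
  by apply/leq_sizeP => k hk; apply: (chebU_coef_eq0 hU); rewrite hk.
rewrite mulr_suml; apply: eq_bigr => k _.
have kn : (k <= n)%N by rewrite -ltnS.
case: ifPn => [|/negPn] ho; last first.
  by rewrite (chebU_coef_eq0 hU) ?mul0r //; move: ho kn; lia.
rewrite -exprM mul2n (even_halfK ho) expr_div_n [LHS]/GRing.scale /= -[RHS]mulrA.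
have -> : s ^+ n = s ^+ k * s ^+ (n - k) by rewrite -exprD subnKC.
by congr (_ * _); rewrite -mulrA mulKf ?expf_neq0.
Qed.

(* Main.v *)
(* In terms of z = x_3 - x_0 the relations read x_- z = q^2 z x_-,
   z x_+ = q^2 x_+ z and x_- x_+ = x_+ x_- + lambda (z + x_0) z, with x_0
   central.  They give B_{x_-} B_z = q^2 B_z B_{x_-}, B_z B_{x_+} = q^2 B_{x_+} B_z
   and [B_{x_0}, B_{x_-}] = 0, so the off-diagonal entries of the powers are
   geometric sums in q^2 or q^4.  Expressing x^2 once through x_+ x_- and once
   through x_- x_+ makes its centrality visible.  Finally L_{x_0} satisfies
   L^2 = 2 b L - c, the recurrence of U_n(b / sqrt c) c^(n/2). *)

Require Import Defs.
From mathcomp Require Import all_boot all_order all_algebra.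
From mathcomp Require Import reals complex monalg ring.

Set Implicit Arguments.
Unset Strict Implicit.
Unset Printing Implicit Defensive.

Import Order.TTheory GRing.Theory Num.Theory.

Local Open Scope ring_scope.

(** * Real scalars acting on a complex algebra *)

Section RealScalars.
Variables (R : realType) (A : algType R[i]).
Implicit Types (x y : A) (r s : R).

Lemma rscalA r s x : r *' (s *' x) = (r * s) *' x.
Proof. by rewrite scalerA -rmorphM. Qed.

Lemma rscalDl r s x : (r + s) *' x = r *' x + s *' x.
Proof. by rewrite -scalerDl -rmorphD. Qed.

Lemma rscal1 x : 1 *' x = x.
Proof. exact: scale1r. Qed.

Lemma rscalAl r x y : (r *' x) * y = r *' (x * y).
Proof. by rewrite scalerAl. Qed.

Lemma rscalAr r x y : x * (r *' y) = r *' (x * y).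
Proof. by rewrite scalerAr. Qed.

(** The factors [r ^+ m] collected here are the terms of the geometric sums in the off-diagonal
    entries of the powers. *)
Lemma rscal_commX r x y m :
  x * y = r *' (y * x) -> x ^+ m * y = (r ^+ m) *' (y * x ^+ m).
Proof.
move=> xy; elim: m => [|m IH]; first by rewrite !expr0 mul1r mulr1 rscal1.
by rewrite exprSr -mulrA xy rscalAr mulrA IH rscalAl rscalA -mulrA -exprSr -exprS.
Qed.

(* Turns a linear identity between four monomials into scalar identities:
   after rewriting with the exhibited f, both sides have the form f _ _ _ _. *)
Lemma linear_coordinates (v1 v2 v3 v4 : A) :
  exists f : R -> R -> R -> R -> A,
    [/\ forall a b c d a' b' c' d',
          f a b c d + f a' b' c' d' = f (a + a') (b + b') (c + c') (d + d'),
        forall r a b c d, r *' f a b c d = f (r * a) (r * b) (r * c) (r * d),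
        forall a b c d, - f a b c d = f (- a) (- b) (- c) (- d),
        0 = f 0 0 0 0
      & [/\ v1 = f 1 0 0 0, v2 = f 0 1 0 0, v3 = f 0 0 1 0 & v4 = f 0 0 0 1]].
Proof.
exists (fun a b c d => a *' v1 + b *' v2 + (c *' v3 + d *' v4)).
have scal0 x : 0 *' x = 0 by rewrite scale0r.
split=> [a b c d a' b' c' d'|r a b c d|a b c d||].
- by rewrite !rscalDl addrACA; congr (_ + _); rewrite addrACA.
- by rewrite !scalerDr !rscalA.
- by rewrite !opprD -!scaleNr -!rmorphN.
- by rewrite !scal0 !addr0.
- by rewrite !scal0 !rscal1 !addr0 !add0r.
Qed.

End RealScalars.

(** * Entrywise arithmetic of 2 x 2 matrices *)

Section Matrix22.
Variable A : nzRingType.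

Lemma mx22_mul (a b c d a' b' c' d' : A) :
  mx22 a b c d * mx22 a' b' c' d' =
  mx22 (a * a' + b * c') (a * b' + b * d') (c * a' + d * c') (c * b' + d * d').
Proof.
apply/matrixP=> i j; rewrite !mxE !big_ord_recl big_ord0 addr0 !mxE /=.
by case: (i == 0); case: (j == 0).
Qed.

Lemma mx22_add (a b c d a' b' c' d' : A) :
  mx22 a b c d + mx22 a' b' c' d' = mx22 (a + a') (b + b') (c + c') (d + d').
Proof. by apply/matrixP=> i j; rewrite !mxE; case: ifP; case: ifP. Qed.

Lemma mx22_opp (a b c d : A) :
  - mx22 a b c d = mx22 (- a) (- b) (- c) (- d).
Proof. by apply/matrixP=> i j; rewrite !mxE; case: ifP; case: ifP. Qed.

Lemma map_mx22 (f : A -> A) (a b c d : A) :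
  map_mx f (mx22 a b c d) = mx22 (f a) (f b) (f c) (f d).
Proof. by apply/matrixP=> i j; rewrite !mxE; case: ifP; case: ifP. Qed.

Lemma mx22_scalar (a : A) : a%:M = mx22 a 0 0 a.
Proof.
apply/matrixP=> i j; rewrite !mxE.
by case: i => [[|[|//]] ?]; case: j => [[|[|//]] ?].
Qed.

End Matrix22.

(** * Real scalars acting on matrices over quantum Minkowski space *)

Section RealMatrixScalars.
Variables (R : realType) (q : R).
Local Notation X := (qMinkowski q).

Lemma rscaleA m n (r s : R) (M : 'M[X]_(m, n)) :
  rscale r (rscale s M) = rscale (r * s) M.
Proof. by apply/matrixP=> i j; rewrite !mxE rscalA. Qed.

Lemma rscaleDl m n (r s : R) (M : 'M[X]_(m, n)) :
  rscale (r + s) M = rscale r M + rscale s M.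
Proof. by apply/matrixP=> i j; rewrite !mxE rscalDl. Qed.

Lemma rscaleDr m n (r : R) (M N : 'M[X]_(m, n)) :
  rscale r (M + N) = rscale r M + rscale r N.
Proof. by apply/matrixP=> i j; rewrite !mxE scalerDr. Qed.

Lemma rscale1 m n (M : 'M[X]_(m, n)) : rscale 1 M = M.
Proof. by apply/matrixP=> i j; rewrite !mxE rscal1. Qed.

Lemma rscaleMl n (r : R) (M N : 'M[X]_n) : rscale r M * N = rscale r (M * N).
Proof.
apply/matrixP=> i j; rewrite !mxE scaler_sumr.
by apply: eq_bigr => k _; rewrite !mxE rscalAl.
Qed.

Lemma rscaleMr n (r : R) (M N : 'M[X]_n) : M * rscale r N = rscale r (M * N).
Proof.
apply/matrixP=> i j; rewrite !mxE scaler_sumr.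
by apply: eq_bigr => k _; rewrite !mxE rscalAr.
Qed.

Lemma rscale_commX n (r : R) (M N : 'M[X]_n) m :
  M * N = rscale r (N * M) -> M ^+ m * N = rscale (r ^+ m) (N * M ^+ m).
Proof.
move=> MN; elim: m => [|m IH]; first by rewrite !expr0 mul1r mulr1 rscale1.
by rewrite exprSr -mulrA MN rscaleMr mulrA IH rscaleMl rscaleA -mulrA -exprSr -exprS.
Qed.

End RealMatrixScalars.

(** * Recurrence and centrality of the homogenized Chebyshev polynomials *)

Section ChebyshevRecurrence.
Variables (K : comNzRingType) (U : nat -> {poly K}) (hU : is_chebyshevU U).
Variables (A : algType K) (b c : A) (bc : b * c = c * b).

Lemma chebU_homog0 : chebU_homog U 0 b c = 1.
Proof.
have [U0 _ _] := (is_chebyshevU_rec U).1 hU.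
by rewrite /chebU_homog big_mkcond big_ord1 /= U0 coef1 scale1r mulr1.
Qed.

Lemma chebU_homog1 : chebU_homog U 1 b c = b *+ 2.
Proof.
have [_ U1 _] := (is_chebyshevU_rec U).1 hU.
rewrite /chebU_homog big_mkcond !big_ord_recl big_ord0 /= U1 coefMn coefX /=.
by rewrite add0r addr0 expr1 mulr1 scaler_nat.
Qed.

Lemma chebU_homog_sum n :
  chebU_homog U n b c =
  \sum_(k < n.+1) (U n)`_k *: (b ^+ k * c ^+ (n - k)./2).
Proof.
rewrite /chebU_homog big_mkcond; apply: eq_bigr => k _.
have kn : (k <= n)%N by rewrite -ltnS.
case: ifPn => // /negPn; rewrite oddB // => nk.
by rewrite (chebU_coef_eq0 hU) ?scale0r // oddD nk orbT.
Qed.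

Lemma chebU_homogSS n :
  chebU_homog U n.+2 b c =
  (b *+ 2) * chebU_homog U n.+1 b c - c * chebU_homog U n b c.
Proof.
have [_ _ Ur] := (is_chebyshevU_rec U).1 hU.
rewrite !chebU_homog_sum.
under eq_bigr => k _ do
  rewrite Ur coefB mulrnAl coefMn coefXM scalerBl.
rewrite sumrB; congr (_ - _).
  (* ['X * U n.+1] has no constant term; shifting k by one gives a factor b and leaves the exponent
     of c equal to that in degree n + 1. *)
  rewrite big_ord_recl /= mul0rn scale0r add0r mulr_sumr.
  apply: eq_bigr => k _.
  by rewrite subSS exprS -scalerAr mulrnAl -scalerMnr -scalerMnl !mulrA.
(* [U n] has degree at most n, so the terms k = n + 1 and k = n + 2 vanish. In the others, n + 2 - k
   has half equal to that of n - k plus one, which supplies the factor c. *)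
rewrite 2!big_ord_recr /= !(@chebU_coef_eq0 _ _ hU n) ?ltnS ?leqnSn ?leqnn //.
rewrite !scale0r !addr0 mulr_sumr; apply: eq_bigr => k _.
have kn : (k <= n)%N by rewrite -ltnS.
rewrite !subSn ?(leqW kn) //= exprS -scalerAr; congr (_ *: _).
by rewrite !mulrA; congr (_ * _); apply/esym/commrX/esym.
Qed.

Lemma chebU_homog_central n :
  (forall y, b * y = y * b /\ c * y = y * c) ->
  forall y, chebU_homog U n b c * y = y * chebU_homog U n b c.
Proof.
move=> bcC y; rewrite /chebU_homog mulr_suml mulr_sumr; apply: eq_bigr => k _.
have [/commr_sym by_ /commr_sym cy] := bcC y.
by rewrite -scalerAl -scalerAr; congr (_ *: _); apply/esym/commrM; apply: commrX.
Qed.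

End ChebyshevRecurrence.

(** Every element is a finite linear combination of words, and a word is built from 1 by multiplying
    by generators on the left. *)
Lemma freeAlg_ind (K : comNzRingType) n (P : freeAlg K n -> Prop) :
    P 1 -> (forall i, P (free_gen K i)) ->
    (forall u v, P u -> P v -> P (u * v)) ->
    (forall u v, P u -> P v -> P (u + v)) ->
    (forall a u, P u -> P (a *: u)) ->
  forall u, P u.
Proof.
move=> P1 Pgen PM PD PZ u.
have P0 : P 0 by rewrite -(scale0r 1); apply: PZ.
have Pmon (s : seq 'I_n) : P (<< FMonom s >> : {malg K[{fmonom 'I_n}]}).
  elim: s => [|i s IH].
    by have -> : FMonom [::] = (mone : {fmonom 'I_n}); [exact/esym/fmoneE | exact: P1].
  have -> : FMonom (i :: s) = mmul (fmu i) (FMonom s).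
    by apply: val_inj; rewrite /= fmM fmU.
  have := PM _ _ (Pgen i) IH.
  rewrite /free_gen [X in P X]malgM_def fgmulUU mulr1; exact: id.
rewrite [u]monalgE; elim/big_rec: _ => [//|k v _ Pv]; apply: PD => //.
have -> : << u@_k *g k >> = u@_k *: (<< k >> : {malg K[{fmonom 'I_n}]}).
  by rewrite -mul_malgC malgM_def fgmulUU mulr1 mul1m.
by rewrite -[X in << X >>]fmK; apply: PZ; apply: Pmon.
Qed.

(** * Quantum integers *)

Section QuantumNumbers.
Variables (R : realType) (q : R) (q_gt0 : 0 < q) (q_neq1 : q != 1).
Local Notation lam := (qlambda q).
Local Notation sq := (Num.sqrt q).
Local Notation s2 := (Num.sqrt (qnum q 2)).

Lemma q_neq0 : q != 0. Proof. exact: lt0r_neq0. Qed.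

Lemma q2B1_neq0 : q ^+ 2 - 1 != 0.
Proof.
rewrite -[1](expr1n _ 2) subr_sqr mulf_neq0 ?subr_eq0 // lt0r_neq0 //.
exact: addr_gt0.
Qed.

Lemma q2D1_neq0 : q ^+ 2 + 1 != 0.
Proof. by rewrite lt0r_neq0 // addr_gt0 // exprn_gt0. Qed.

Lemma qlambda_neq0 : lam != 0.
Proof.
have -> : lam = (q ^+ 2 - 1) / q by rewrite /qlambda; field; exact: q_neq0.
by rewrite mulf_neq0 ?invr_eq0 ?q2B1_neq0 ?q_neq0.
Qed.

Lemma qnum2E : qnum q 2 = q + q^-1.
Proof.
rewrite /qnum -/lam; apply: (mulIf qlambda_neq0).
by rewrite divfK ?qlambda_neq0 // /qlambda; field; exact: q_neq0.
Qed.

Lemma qnum2_gt0 : 0 < qnum q 2.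
Proof. by rewrite qnum2E addr_gt0 ?invr_gt0. Qed.

Lemma qnum4E : qnum q 4 = (q + q^-1) * (q ^+ 2 + q ^- 2).
Proof.
rewrite /qnum -/lam; apply: (mulIf qlambda_neq0).
by rewrite divfK ?qlambda_neq0 // /qlambda; field; exact: q_neq0.
Qed.

Lemma sqrt_coef_mul :
  sq^-1 * lam * s2^-1 * (sq * lam * s2^-1) = lam ^+ 2 / qnum q 2.
Proof.
have sq0 : sq != 0 by rewrite sqrtr_eq0 -ltNge.
have s20 : s2 != 0 by rewrite sqrtr_eq0 -ltNge qnum2_gt0.
rewrite -[in RHS](sqr_sqrtr (ltW qnum2_gt0)); field.
by rewrite sq0 s20.
Qed.

(** Since [n+1] = q^n + q^(n-2) + ... + q^(-n), this splits off the highest term; [qnumSV] splits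
    off the lowest. *)
Lemma qnumS n : qnum q n.+1 = q ^+ n + q^-1 * qnum q n.
Proof.
rewrite /qnum -/lam; apply: (mulIf qlambda_neq0).
rewrite [RHS]mulrDl -[X in _ = _ + X]mulrA !divfK ?qlambda_neq0 // /qlambda !exprS.
by field; rewrite q_neq0 expf_neq0 ?q_neq0.
Qed.

Lemma qnumSV n : qnum q n.+1 = q ^- n + q * qnum q n.
Proof.
rewrite /qnum -/lam; apply: (mulIf qlambda_neq0).
rewrite [RHS]mulrDl -[X in _ = _ + X]mulrA !divfK ?qlambda_neq0 // /qlambda !exprS.
by field; rewrite q_neq0 expf_neq0 ?q_neq0.
Qed.

Lemma qnum1 : qnum q 1 = 1.
Proof. by rewrite /qnum !expr1 divff ?qlambda_neq0. Qed.

(** The quotient [2n]/[2] is the quantum integer [n] at q^2 in place of q, so this is [qnumS] at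
    q^2. *)
Lemma qnum_doubleS n :
  qnum q (2 * n.+1) / qnum q 2 =
  q ^+ n ^+ 2 + q ^- 2 * (qnum q (2 * n) / qnum q 2).
Proof.
have qn2_neq0 := lt0r_neq0 qnum2_gt0.
rewrite mulnS add2n (qnumS (2 * n).+1) (qnumS (2 * n)) exprS mulnC exprM.
(* Writing q as [2] - q^(-1) leaves an identity that holds with [2] as an independent unknown. *)
have -> : q * q ^+ n ^+ 2 = (qnum q 2 - q^-1) * q ^+ n ^+ 2.
  by rewrite qnum2E addrK.
by field; rewrite q_neq0 qn2_neq0.
Qed.

End QuantumNumbers.

(** * Consequences of the defining relations in terms of z = x_3 - x_0 *)

Section Relations.
Variables (R : realType) (q : R) (q_gt0 : 0 < q) (q_neq1 : q != 1).
Variables (A : algType R[i]) (x0 xm xp x3 z : A).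
Hypothesis rel : forall u v, qMinkowski_rel q x0 xm xp x3 u v -> u = v.
Hypothesis x3E : x3 = x0 + z.
Local Notation lam := (qlambda q).
Let q0 : q != 0 := q_neq0 q_gt0.
Let q2D1 : q * q + 1 != 0 := q2D1_neq0 q_gt0.

Lemma xm_x0 : xm * x0 = x0 * xm.
Proof. exact/esym/rel/qMinkowski_rel0m. Qed.

Lemma xp_x0 : xp * x0 = x0 * xp.
Proof. exact/esym/rel/qMinkowski_rel0p. Qed.

Lemma z_x0 : z * x0 = x0 * z.
Proof.
have -> : z = x3 - x0 by rewrite x3E addrC addKr.
by rewrite mulrBl mulrBr (rel (qMinkowski_rel03 q x0 xm xp x3)).
Qed.

Ltac expand :=
  rewrite ?(@expr2 A) ?(@mulrDl A, @mulrDr A, @mulNr A, @mulrN A, rscalAl,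
    rscalAr, scalerDr, scalerN, @mulrA A).

(** The arguments are the normally ordered monomials of the goal, whose coefficients are compared;
    monomials absent from the goal merely fill the four places. *)
Ltac linear v1 v2 v3 v4 :=
  let f := fresh "f" in let fD := fresh "f" in let fZ := fresh "f" in
  let fN := fresh "f" in let f0 := fresh "f" in
  let e1 := fresh "e" in let e2 := fresh "e" in
  let e3 := fresh "e" in let e4 := fresh "e" in
  have [f [fD fZ fN f0 [e1 e2 e3 e4]]] := linear_coordinates v1 v2 v3 v4;
  rewrite ?e1 ?e2 ?e3 ?e4 ?f0 ?(fZ, fD, fN); congr (f _ _ _ _);
  rewrite ?(qnum4E q_gt0 q_neq1) ?(qnum2E q_gt0 q_neq1) /qlambda;
  field; rewrite ?q0 ?q2D1.

Lemma xm_z : xm * z = q ^+ 2 *' (z * xm).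
Proof.
have := rel (qMinkowski_relm3 q x0 xm xp x3).
rewrite x3E => r.
(* The first summand is q times the left side of the relation, and the rest corrects it to x_- z.
   After [r] is applied, the x_0 x_- terms cancel because q lambda = q^2 - 1. *)
have -> : xm * z =
    q *' (q^-1 *' (xm * (x0 + z)) - q *' ((x0 + z) * xm))
    + (q ^+ 2 *' (z * xm) + (q ^+ 2 - 1) *' (x0 * xm)).
  by expand; rewrite xm_x0; linear (x0 * xm) (z * xm) (xm * z) (x0 * x0).
by rewrite r xm_x0; linear (x0 * xm) (z * xm) (x0 * x0) (x0 * z).
Qed.

Lemma z_xp : z * xp = q ^+ 2 *' (xp * z).
Proof.
have := rel (qMinkowski_rel3p q x0 xm xp x3).
rewrite x3E => r.
have -> : z * xp =
    q *' (q^-1 *' ((x0 + z) * xp) - q *' (xp * (x0 + z)))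
    + (q ^+ 2 *' (xp * z) + (q ^+ 2 - 1) *' (x0 * xp)).
  by expand; rewrite xp_x0; linear (x0 * xp) (xp * z) (z * xp) (x0 * x0).
by rewrite r xp_x0; linear (x0 * xp) (xp * z) (x0 * x0) (x0 * z).
Qed.

Lemma xm_xp : xm * xp = xp * xm + (lam *' (x0 * z) + lam *' (z * z)).
Proof.
have := rel (qMinkowski_relmp q x0 xm xp x3).
rewrite x3E => r.
have -> : xm * xp = (xm * xp - xp * xm - lam *' ((x0 + z) * (x0 + z)))
    + (xp * xm + lam *' ((x0 + z) * (x0 + z))).
  by rewrite addrACA subrK addNr addr0.
rewrite r; expand; rewrite z_x0.
by linear (x0 * x0) (x0 * z) (z * z) (xp * xm).
Qed.

(** The element x^2 formed in any algebra satisfying the relations; [qM_square] is the instance at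
    the generators of quantum Minkowski space. *)
Definition square : A := x0 ^+ 2 + q^-1 *' (xm * xp) + q *' (xp * xm) - x3 ^+ 2.

Lemma square_xp_xmE :
  square = qnum q 2 *' (xp * xm)
    - (q ^- 2 *' (z * z) + (1 + q ^- 2) *' (x0 * z)).
Proof.
rewrite /square x3E xm_xp; expand; rewrite z_x0.
by linear (x0 * x0) (x0 * z) (z * z) (xp * xm).
Qed.

Lemma square_xm_xpE :
  square = qnum q 2 *' (xm * xp)
    - (q ^+ 2 *' (z * z) + (1 + q ^+ 2) *' (x0 * z)).
Proof.
rewrite square_xp_xmE xm_xp; expand.
by linear (x0 * x0) (x0 * z) (z * z) (xp * xm).
Qed.

Lemma square_comm_x0 : square * x0 = x0 * square.
Proof.
rewrite square_xp_xmE; expand; congr (_ *' _ - (_ *' _ + _ *' _)).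
- by rewrite -(mulrA xp) xm_x0 mulrA xp_x0.
- by rewrite -(mulrA z) z_x0 mulrA z_x0.
- by rewrite -(mulrA x0 z) z_x0 mulrA.
Qed.

Lemma square_comm_xm : square * xm = xm * square.
Proof.
(* With this choice of forms both sides contain [2] x_- x_+ x_-. Moving x_- to the right past z or
   z^2 gives q^2 or q^4, which turns the coefficients 1 + q^(-2) and q^(-2) into those of the other
   form. *)
rewrite {1}square_xm_xpE square_xp_xmE; expand.
rewrite xm_z xm_x0; expand.
rewrite -(mulrA z xm) xm_z -(mulrA x0 xm) xm_z; expand.
by linear (xm * xp * xm) (z * z * xm) (x0 * z * xm) (x0 * x0).
Qed.

Lemma square_comm_xp : square * xp = xp * square.
Proof.
rewrite {1}square_xp_xmE square_xm_xpE; expand.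
rewrite -(mulrA z) z_xp xp_x0 -(mulrA x0 z) z_xp; expand.
rewrite z_xp; expand.
by linear (xp * xm * xp) (xp * z * z) (x0 * xp * z) (x0 * x0).
Qed.

Lemma square_comm_z : square * z = z * square.
Proof.
(* Both x_+ x_- z and z x_+ x_- equal q^2 x_+ z x_-. *)
rewrite square_xp_xmE; expand; rewrite z_xp -(mulrA xp) xm_z z_x0; expand.
by linear (xp * z * xm) (z * z * z) (x0 * z * z) (x0 * x0).
Qed.

(** * Commutation relations and quadratic equation of the B matrices *)

Section BMatrices.
(** These stand for q^(-1/2) lambda [2]^(-1/2) and q^(1/2) lambda [2]^(-1/2). Fixing only their
    product keeps square roots out of the computations. *)
Variables (k k' : R) (kk' : k * k' = lam ^+ 2 / qnum q 2).

Let Bm := mx22 xm (k *' z) 0 xm.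
Let Bp := mx22 xp 0 (- (k' *' z)) xp.
Let Bz := mx22 (q^-1 *' z) 0 0 (q *' z).
Let B0 := mx22 ((qnum q 4 / qnum q 2 ^+ 2) *' x0 + (lam / (q * qnum q 2)) *' x3)
  (k *' xp) (- (k' *' xm))
  ((qnum q 4 / qnum q 2 ^+ 2) *' x0 - (q * lam / qnum q 2) *' x3).

Let k'k : k' * k = lam ^+ 2 / qnum q 2. Proof. by rewrite mulrC. Qed.

(** On the diagonal, the defect from x_- z = q^2 z x_- is exactly compensated by the product k k' z
    x_- of off-diagonal entries. The upper right entry is the relation x_- x_+ - x_+ x_- = lambda
    x_3 z, because (q + q^(-1)) / [2] = 1. *)
Lemma B0_Bm : B0 * Bm = Bm * B0.
Proof.
rewrite !mx22_mul x3E; congr mx22.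
all: rewrite ?(mul0r, mulr0, addr0, add0r).
- expand; rewrite ?(rscalA, kk', k'k) xm_x0 xm_z.
  by linear (x0 * xm) (z * xm) (x0 * x0) (x0 * z).
- expand; rewrite z_x0 xm_xp; expand; rewrite ?(rscalA, kk', k'k).
  by linear (x0 * z) (z * z) (xp * xm) (x0 * x0).
- expand; congr (- _).
- expand; rewrite ?(rscalA, kk', k'k) xm_x0 xm_z.
  by linear (x0 * xm) (z * xm) (x0 * x0) (x0 * z).
Qed.

Lemma Bm_Bz : Bm * Bz = map_mx (fun x => q ^+ 2 *' x) (Bz * Bm).
Proof.
rewrite !mx22_mul map_mx22; congr mx22.
all: rewrite ?(mul0r, mulr0, addr0, add0r, scaler0) //.
- by expand; rewrite xm_z; linear (z * xm) (x0 * x0) (x0 * z) (z * z).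
- by expand; linear (z * z) (x0 * x0) (x0 * z) (z * xm).
- by expand; rewrite xm_z; linear (z * xm) (x0 * x0) (x0 * z) (z * z).
Qed.

Lemma Bz_Bp : Bz * Bp = map_mx (fun x => q ^+ 2 *' x) (Bp * Bz).
Proof.
rewrite !mx22_mul map_mx22; congr mx22.
all: rewrite ?(mul0r, mulr0, addr0, add0r, scaler0) //.
- by expand; rewrite z_xp; linear (xp * z) (x0 * x0) (x0 * z) (z * z).
- by expand; linear (z * z) (x0 * x0) (x0 * z) (z * xm).
- by expand; rewrite z_xp; linear (xp * z) (x0 * x0) (x0 * z) (z * z).
Qed.

(** A Cayley-Hamilton identity with [2] x_0 and c in place of trace and determinant. Off the
    diagonal the z terms cancel after reordering, leaving [2] x_0 as the linear coefficient; on the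
    diagonal, k k' brings in the products of x_+ and x_- that make up x^2. *)
Lemma B0_sqr : B0 * B0 =
 (qnum q 2 *' x0)%:M * B0 - (x0 ^+ 2 + (lam ^+ 2 / qnum q 2 ^+ 2) *' square)%:M.
Proof.
rewrite !mx22_scalar mx22_opp !mx22_mul mx22_add square_xp_xmE x3E; congr mx22.
all: rewrite ?(mul0r, mulr0, addr0, add0r, oppr0) //.
- expand; rewrite z_x0 ?(rscalA, kk', k'k).
  by linear (x0 * x0) (x0 * z) (z * z) (xp * xm).
- expand; rewrite z_xp xp_x0.
  by linear (x0 * xp) (xp * z) (x0 * z) (x0 * x0).
- expand; rewrite xm_z xm_x0.
  by linear (x0 * xm) (z * xm) (x0 * z) (x0 * x0).
- expand; rewrite z_x0 xm_xp; expand; rewrite ?(rscalA, kk', k'k).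
  by linear (x0 * x0) (x0 * z) (z * z) (xp * xm).
Qed.

End BMatrices.
End Relations.

(** * Powers of diagonal and triangular 2 x 2 matrices *)

Section BPowers.
Variables (R : realType) (q : R) (q_gt0 : 0 < q) (q_neq1 : q != 1).
Variables (A : algType R[i]) (x z : A).
Let q0 : q != 0 := q_neq0 q_gt0.

Lemma diag_exp (r s : R) n :
  mx22 (r *' z) 0 0 (s *' z) ^+ n.+1 =
  mx22 (r ^+ n.+1 *' z ^+ n.+1) 0 0 (s ^+ n.+1 *' z ^+ n.+1).
Proof.
elim: n => [|n IH]; first by rewrite !expr1.
rewrite exprSr IH mx22_mul !(mulr0, mul0r, addr0, add0r).
by rewrite !rscalAl !rscalAr !rscalA -!exprSr.
Qed.

(** The corner entry is k times the sum of x^i z x^(n-i) for i from 0 to n. Each term is q^(2i) z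
    x^n, and these factors add up to q^n [n+1]. *)
Lemma upper_exp (k : R) n : x * z = q ^+ 2 *' (z * x) ->
  mx22 x (k *' z) 0 x ^+ n.+1 =
  mx22 (x ^+ n.+1) ((k * q ^+ n * qnum q n.+1) *' (z * x ^+ n)) 0 (x ^+ n.+1).
Proof.
move=> xz; elim: n => [|n IH].
  by rewrite !expr1 expr0 qnum1 // !mulr1.
rewrite exprSr IH mx22_mul !(mulr0, mul0r, addr0, add0r) -!exprSr.
congr mx22; rewrite rscalAr (rscal_commX _ xz) rscalA rscalAl -(mulrA z) -exprSr.
rewrite -rscalDl; congr (_ *' _); rewrite (qnumS _ _ n.+1) // -exprM mul2n -addnn exprD !exprS.
by field.
Qed.

(** Now x passes z with factor q^(-2), so the sum is q^(-n) [n+1] and the induction uses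
    [qnumSV]. *)
Lemma lower_exp (k : R) n : z * x = q ^+ 2 *' (x * z) ->
  mx22 x 0 (- (k *' z)) x ^+ n.+1 =
  mx22 (x ^+ n.+1) 0 (- ((k * q ^- n * qnum q n.+1) *' (z * x ^+ n))) (x ^+ n.+1).
Proof.
move=> zx; have xz : x * z = q ^- 2 *' (z * x).
  by rewrite zx rscalA mulVf ?expf_neq0 // rscal1.
elim: n => [|n IH].
  by rewrite !expr1 !expr0 qnum1 // invr1 !mulr1.
rewrite exprSr IH mx22_mul !(mulr0, mul0r, addr0, add0r) -!exprSr.
congr mx22; rewrite mulNr mulrN -opprD; congr (- _).
rewrite rscalAr (rscal_commX _ xz) rscalA rscalAl -(mulrA z) -exprSr.
rewrite -rscalDl; congr (_ *' _).
rewrite (qnumSV _ _ n.+1) // exprVn -exprM mul2n -addnn exprD !exprS.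
by field; rewrite expf_neq0.
Qed.

End BPowers.

(** * Powers of the L matrices, and induction on quantum Minkowski space *)

Section LPowers.
Variables (R : realType) (q : R) (q_gt0 : 0 < q) (q_neq1 : q != 1).
Local Notation X := (qMinkowski q).
Let q0 : q != 0 := q_neq0 q_gt0.

Lemma block_diag_exp (M N : 'M[X]_2) n :
  (block_mx M 0 0 N : 'M[X]_(2 + 2)) ^+ n = block_mx (M ^+ n) 0 0 (N ^+ n).
Proof.
elim: n => [|n IH]; first by rewrite !expr0 -scalar_mx_block.
rewrite exprSr IH -mulmxE mulmx_block !(mulmx0, mul0mx, addr0, add0r).
by rewrite !mulmxE -!exprSr.
Qed.

Lemma rscaleX (r : R) (M : 'M[X]_2) n : rscale r M ^+ n = rscale (r ^+ n) (M ^+ n).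
Proof.
elim: n => [|n IH]; first by rewrite !expr0 rscale1.
by rewrite exprSr IH rscaleMl rscaleMr rscaleA -!exprSr.
Qed.

(** The corner block is K times the sum over i from 0 to n of q^(2i-n) Bm^i (Bz + B0) Bm^(n-i).
    Moving Bm^i past Bz contributes another q^(2i), so the Bz part sums q^(4i-n) to q^n [2n+2]/[2];
    B0 commutes with Bm, and its part sums q^(2i-n) to [n+1]. *)
Lemma L_xm_exp (Bm Bz B0 : 'M[X]_2) (K : R) n :
    Bm * Bz = rscale (q ^+ 2) (Bz * Bm) -> B0 * Bm = Bm * B0 ->
  (block_mx (rscale q Bm) (rscale K (Bz + B0)) 0 (rscale q^-1 Bm)
     : 'M[X]_(2 + 2)) ^+ n.+1 =
  block_mx (rscale (q ^+ n.+1) (Bm ^+ n.+1))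
    (rscale K ((rscale (q ^+ n * (qnum q (2 * n.+1) / qnum q 2)) Bz
                + rscale (qnum q n.+1) B0) * Bm ^+ n))
    0 (rscale (q ^- n.+1) (Bm ^+ n.+1)).
Proof.
move=> mz m0; have qn2 := lt0r_neq0 (qnum2_gt0 q_gt0 q_neq1).
elim: n => [|n IH].
  by rewrite !expr1 expr0 mulr1 muln1 divff // qnum1 // mulr1 !rscale1.
rewrite exprSr IH -mulmxE mulmx_block !(mulmx0, mul0mx, addr0, add0r) !mulmxE.
rewrite !(rscaleMl, rscaleMr, rscaleA) -invfM -!exprSr; congr block_mx.
rewrite mulrDr (rscale_commX _ mz) -(commrX _ m0).
rewrite -mulrA -exprSr !mulrDl !rscaleMl !rscaleDr !rscaleA addrACA -!rscaleDl.
congr (rscale _ _ + rscale _ _); last first.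
  by rewrite (qnumS _ _ n.+1) //; ring.
rewrite (qnum_doubleS _ _ n.+1) // exprAC (exprS q n).
set t := qnum q (2 * n.+1) / _; field.
by rewrite q0.
Qed.

(** The geometric sum of [upper_exp], with 2 x 2 blocks as entries. *)
Lemma L_x30_exp (Bp Bz : 'M[X]_2) (K : R) n :
    Bz * Bp = rscale (q ^+ 2) (Bp * Bz) ->
  (block_mx Bz (rscale K Bp) 0 Bz : 'M[X]_(2 + 2)) ^+ n.+1 =
  block_mx (Bz ^+ n.+1) (rscale (K * q ^+ n * qnum q n.+1) (Bp * Bz ^+ n))
    0 (Bz ^+ n.+1).
Proof.
move=> zp; elim: n => [|n IH].
  by rewrite !expr1 expr0 qnum1 // !mulr1.
rewrite exprSr IH -mulmxE mulmx_block !(mulmx0, mul0mx, addr0, add0r) !mulmxE.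
rewrite -!exprSr; congr block_mx.
rewrite rscaleMr (rscale_commX _ zp) rscaleA rscaleMl -(mulrA Bp) -exprSr -rscaleDl.
congr (rscale _ _); rewrite (qnumS _ _ n.+1) // -exprM mul2n -addnn exprD !exprS.
by field.
Qed.

Lemma qMinkowski_ind (P : X -> Prop) :
    P 1 -> P (qM_x0 q) -> P (qM_xm q) -> P (qM_xp q) -> P (qM_x3 q) ->
    (forall u v, P u -> P v -> P (u * v)) ->
    (forall u v, P u -> P v -> P (u + v)) ->
    (forall a u, P u -> P (a *: u)) ->
  forall u, P u.
Proof.
move=> P1 P00 Pm Pp P3 PM PD PZ u.
have [w <-] := quotient_surj u.
elim/freeAlg_ind: w => [|i|v w Pv Pw|v w Pv Pw|a v Pv].
- by rewrite rmorph1.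
(* The four generators are defined through [inord], so the ordinals from the case analysis are
   brought to that form. *)
- have ordE k (ltk : (k < 4)%N) : Ordinal ltk = inord k.
    by apply: val_inj; rewrite /= inordK.
  by case: i => [[|[|[|[|//]]]] lti]; rewrite ordE.
- by rewrite rmorphM; apply: PM.
- by rewrite rmorphD; apply: PD.
- by rewrite linearZ; apply: PZ.
Qed.

End LPowers.

(** With V_n for [chebU_homog U n b c], multiplying by L and replacing L^2 makes the constant term
    -c V_(n+1) and the coefficient of L equal to 2b V_(n+1) - c V_n, which is V_(n+2) by the
    recurrence. Centrality lets the scalars be reordered. *)
Lemma chebyshev_exp (K : comNzRingType) (U : nat -> {poly K})
    (hU : is_chebyshevU U) (A : algType K) (b c : A) m (L : 'M[A]_m) n :
    (forall y, b * y = y * b /\ c * y = y * c) ->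
    L * L = (b *+ 2)%:M * L - c%:M ->
  L ^+ n.+2 =
  - (c * chebU_homog U n b c)%:M + (chebU_homog U n.+1 b c)%:M * L.
Proof.
move=> bcC L2; have VC := chebU_homog_central U _ bcC.
elim: n => [|n IH].
  by rewrite expr2 L2 chebU_homog0 // chebU_homog1 // mulr1 addrC.
have sM (x y : A) : (x * y)%:M = x%:M * y%:M :> 'M_m := scalar_mxM m x y.
have bc : b * c = c * b by have [] := bcC c.
rewrite exprSr IH (chebU_homogSS hU bc) raddfB /= mulrDl mulrBl mulNr -mulrA L2.
rewrite -(VC n c) -(VC n.+1 c) -(VC n.+1 (b *+ 2)) mulrBr !sM mulrA.
by rewrite addrCA [RHS]addrCA; congr (_ + _); rewrite addrC.
Qed.

(** * Centrality of x_0, x^2, b and c, and the quadratic equation of L_{x_0} *)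

Section Main.
Variables (R : realType) (q : R) (q_gt0 : 0 < q) (q_neq1 : q != 1).
Local Notation X := (qMinkowski q).
Local Notation x0 := (qM_x0 q).
Local Notation xm := (qM_xm q).
Local Notation xp := (qM_xp q).
Local Notation x3 := (qM_x3 q).

Let x3E : x3 = x0 + qM_x30 q. Proof. by rewrite /qM_x30 addrC subrK. Qed.
Let rel := @qMinkowski_relE R q.

Lemma commutes_with_generators_central (y : X) :
  y * x0 = x0 * y -> y * xm = xm * y -> y * xp = xp * y -> y * x3 = x3 * y ->
  forall u, y * u = u * y.
Proof.
move=> y0 ym yp y3 u.
elim/qMinkowski_ind: u => // [|u v yu yv|u v yu yv|a u yu].
- by rewrite mulr1 mul1r.
- by rewrite mulrA yu -mulrA yv mulrA.
- by rewrite mulrDr mulrDl yu yv.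
- by rewrite -scalerAl -scalerAr yu.
Qed.

Lemma x0_central (u : X) : x0 * u = u * x0.
Proof.
apply: commutes_with_generators_central => //; apply: rel;
  [exact: qMinkowski_rel0m | exact: qMinkowski_rel0p | exact: qMinkowski_rel03].
Qed.

Lemma qM_square_central (u : X) : qM_square q * u = u * qM_square q.
Proof.
apply: commutes_with_generators_central.
- exact: (square_comm_x0 q_gt0 q_neq1 rel x3E).
- exact: (square_comm_xm q_gt0 q_neq1 rel x3E).
- exact: (square_comm_xp q_gt0 q_neq1 rel x3E).
(* The commutation is available for z, so x_3 is split as x_0 + z. *)
- rewrite x3E (mulrDr (qM_square q)) (mulrDl x0).
  congr (_ + _); first exact: (square_comm_x0 q_gt0 q_neq1 rel x3E).
  exact: (square_comm_z q_gt0 q_neq1 rel x3E).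
Qed.

Lemma central_bc (y : X) :
  central_b q * y = y * central_b q /\ central_c q * y = y * central_c q.
Proof.
split; first by rewrite /central_b rscalAl rscalAr x0_central.
rewrite /central_c mulrDl mulrDr rscalAl rscalAr qM_square_central; congr (_ + _).
by rewrite expr2 -mulrA x0_central -mulrA x0_central mulrA.
Qed.

Lemma L_x0_sqr :
  L_x0 q * L_x0 q = (central_b q *+ 2)%:M * L_x0 q - (central_c q)%:M.
Proof.
have kk' : (Num.sqrt q)^-1 * qlambda q * (Num.sqrt (qnum q 2))^-1 *
    (Num.sqrt q * qlambda q * (Num.sqrt (qnum q 2))^-1)
    = qlambda q ^+ 2 / qnum q 2.
  exact: sqrt_coef_mul.
have B2 : B_x0 q * B_x0 q = (central_b q *+ 2)%:M * B_x0 q - (central_c q)%:M.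
  have -> : central_b q *+ 2 = qnum q 2 *' x0.
    rewrite /central_b scalerMnl -rmorphMn -[_ *+ 2]mulr_natr divfK //.
    by rewrite pnatr_eq0.
  exact: (B0_sqr q_gt0 q_neq1 rel x3E kk').
rewrite -!mulmxE !(@scalar_mx_block _ 2 2) !mulmx_block.
rewrite !(mulmx0, mul0mx, addr0, add0r) opp_block_mx add_block_mx !oppr0 !addr0.
by rewrite !mulmxE B2.
Qed.

End Main.

Theorem mainTheorem7 (R : realType) (q : R) (q_gt0 : 0 < q) (q_neq1 : q != 1)
    (U : nat -> {poly R[i]}) (hU : is_chebyshevU U) :
  let lam := qlambda q in
  let sq := Num.sqrt q in
  let s2 := Num.sqrt (qnum q 2) in
  let b := central_b q in
  let c := central_c q in
  [/\ (forall n : nat, (1 <= n)%N ->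
        [/\ L_x0 q ^+ n = block_mx (B_x0 q ^+ n) 0 0 (B_x0 q ^+ n),
            L_xp q ^+ n =
              block_mx (rscale (q ^- n) (B_xp q ^+ n)) 0
                       0 (rscale (q ^+ n) (B_xp q ^+ n)),
            L_xm q ^+ n =
              block_mx
                (rscale (q ^+ n) (B_xm q ^+ n))
                (rscale (sq^-1 * lam * s2)
                  ((rscale (q ^+ n.-1 * (qnum q (2 * n) / qnum q 2)) (B_x30 q)
                    + rscale (qnum q n) (B_x0 q)) * B_xm q ^+ n.-1))
                0
                (rscale (q ^- n) (B_xm q ^+ n))
          & L_x30 q ^+ n =
              block_mx
                (B_x30 q ^+ n)
                (rscale (sq^-1 * lam * s2 * q ^+ n.-1 * qnum q n)
                  (B_xp q * B_x30 q ^+ n.-1))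
                0
                (B_x30 q ^+ n)]),
      (forall n : nat, (1 <= n)%N ->
        [/\ B_x30 q ^+ n =
              mx22 (q ^- n *' (qM_x30 q ^+ n)) 0
                   0 (q ^+ n *' (qM_x30 q ^+ n)),
            B_xm q ^+ n =
              mx22 (qM_xm q ^+ n)
                   ((sq^-1 * lam * s2^-1 * q ^+ n.-1 * qnum q n)
                      *' (qM_x30 q * qM_xm q ^+ n.-1))
                   0
                   (qM_xm q ^+ n)
          & B_xp q ^+ n =
              mx22 (qM_xp q ^+ n)
                   0
                   (- ((sq * lam * s2^-1 * q ^- n.-1 * qnum q n)
                         *' (qM_x30 q * qM_xp q ^+ n.-1)))
                   (qM_xp q ^+ n)]),
      (forall y : qMinkowski q, b * y = y * b /\ c * y = y * c)
    & forall n : nat, (2 <= n)%N ->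
        L_x0 q ^+ n = - (c * chebU_homog U (n - 2) b c)%:M
                      + (chebU_homog U (n - 1) b c)%:M * L_x0 q
        /\
        L_x0 q ^+ n = (chebU_homog U n b c)%:M
                      + (chebU_homog U (n - 1) b c)%:M
                        * (L_x0 q - (b *+ 2)%:M)].
Proof.
move=> lam sq s2 b c.
have x3E : qM_x3 q = qM_x0 q + qM_x30 q by rewrite /qM_x30 addrC subrK.
have rel := @qMinkowski_relE R q.
have kk' : sq^-1 * lam * s2^-1 * (sq * lam * s2^-1) = lam ^+ 2 / qnum q 2.
  exact: sqrt_coef_mul.
have mz : B_xm q * B_x30 q = rscale (q ^+ 2) (B_x30 q * B_xm q).
  exact: (Bm_Bz q_gt0 rel x3E).
have zp : B_x30 q * B_xp q = rscale (q ^+ 2) (B_xp q * B_x30 q).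
  exact: (Bz_Bp q_gt0 rel x3E).
have m0 : B_x0 q * B_xm q = B_xm q * B_x0 q.
  exact: (B0_Bm q_gt0 q_neq1 rel x3E kk').
split=> [[//|n] _|[//|n] _|y|[|[|n]] // _].
- split.
  + exact: block_diag_exp.
  + by rewrite /L_xp block_diag_exp !rscaleX exprVn.
  + exact: L_xm_exp.
  + exact: L_x30_exp.
- split.
  + by rewrite /B_x30 diag_exp exprVn.
  + exact/upper_exp/(xm_z q_gt0 rel x3E).
  + exact/lower_exp/(z_xp q_gt0 rel x3E).
- exact: central_bc.
- have bcC := central_bc q_gt0 q_neq1.
  have Ln := chebyshev_exp hU n bcC (L_x0_sqr q_gt0 q_neq1).
  rewrite !subSS !subn0; split=> //.
  have bc : b * c = c * b by have [] := bcC c.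
  (* The recurrence in degree n + 2 turns the second form into the first: its 2b V_(n+1) cancels
     against the subtracted 2b, leaving -c V_n. *)
  rewrite Ln (chebU_homogSS hU bc) mulrBr.
  have -> : (chebU_homog U n.+1 b c)%:M * (b *+ 2)%:M =
      (chebU_homog U n.+1 b c * (b *+ 2))%:M :> 'M_4 by exact/esym/scalar_mxM.
  rewrite (chebU_homog_central U _ bcC (b *+ 2)).
  by rewrite raddfB /= [RHS]addrC addrA subrK addrC.
Qed.
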